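(* Let $K$ be a number field and let $f:\mathbb{P}^n\dashrightarrow\mathbb{P}^n$ be a rational map defined over $K$, with indeterminacy locus $I(f)$. Suppose that for some nonempty Zariski open set $U$ of $\mathbb{P}^n$ and some constant $C$, $$\frac{1}{\deg f}h\bigl(f(P)\bigr)+C>h(P)\qquad\text{for all }P\in U(\overline K)\setminus I(f).$$ Then $f$ is an endomorphism, i.e. $f$ is a morphism $\mathbb{P}^n\to\mathbb{P}^n$.
   Context: $h:\mathbb{P}^n(\overline K)\to\mathbb{R}$ is the logarithmic absolute Weil height. A rational map $f:\mathbb{P}^n\dashrightarrow\mathbb{P}^n$ is written $f=[f_0,\dots,f_n]$ with $f_i$ homogeneous polynomials of the same degree $d$ without common factor; $\deg f=d$ (with $d\geq 1$, so that $1/\deg f$ makes sense), and $I(f)$ is the common zero locus of the $f_i$. *)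

(* Defs.v *)
From HB Require Import structures.
From mathcomp Require Import all_boot all_order all_algebra all_field.
From mathcomp Require Import all_classical all_reals exp.
From mathcomp Require Import complex.
(* The notations of mpoly.v clash with those of MathComp-Analysis. *)
From mathcomp Require Import -(notations) mpoly.

Set Implicit Arguments.
Unset Strict Implicit.
Unset Printing Implicit Defensive.

Import Order.TTheory GRing.Theory Num.Theory.
Local Open Scope classical_set_scope.
Local Open Scope ring_scope.

(* Conventions.  The algebraic closure of a number field K is algC, K being
   embedded in it by some iota : {rmorphism K -> algC}.  A point of P^n over
   algC is given by homogeneous coordinates, i.e. by a nonzero x : 'rV_n.+1. *)

Section Height.
Variable R : realType.

(* v is the normalized absolute value ||.||_p = N(p)^(- ord_p(.)) (that is,
   |.|_p to the power of the local degree [L_p : Q_p]) of some maximal ideal p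
   of the ring of integers of L: it is ultrametric, its residue field is finite,
   of cardinal q say, and its value group is q^Z.  The family r lists, exactly
   once each, representatives of the residue classes of {v <= 1} modulo
   {v < 1}. *)
Definition finite_place (L : fieldExtType rat) (v : L -> R) : Prop :=
  [/\ v 0 = 0,
      forall x y, v (x * y) = v x * v y,
      forall x y, v (x + y) <= Num.max (v x) (v y) &
      exists q : nat,
        (exists r : 'I_q -> L, (forall i, v (r i) <= 1) /\
           (forall x, v x <= 1 -> exists! i, v (x - r i) < 1)) /\
        v @` [set x | x != 0] = range (fun k : int => (q%:R : R) ^ k)].

(* The sum over the archimedean places, with weights [L_v : Q_v], is written as
   the sum over all the embeddings of L in the complex numbers: a complex place
   has weight 2 and comes from two conjugate embeddings. *)
Definition field_height (L : fieldExtType rat) (m : nat) (y : 'I_m -> L) : R :=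
  ((\dim {:L})%:R)^-1 *
  (\sum_(s \in range (fun s : {rmorphism L -> R[i]} => (s : L -> R[i])))
      ln (\big[Num.max/0]_(i < m) ComplexField.Normc.normc (s (y i)))
   + \sum_(v \in [set v : L -> R | finite_place v])
      ln (\big[Num.max/0]_(i < m) v (y i))).

(* The logarithmic absolute Weil height of the point with homogeneous
   coordinates x <> 0, computed in the number field Q(x_0, ..., x_n) provided by
   num_field_exists; s lists the x_i as elements of this field.  By the product
   formula the value only depends on the point. *)
Definition weil_height (n : nat) (x : 'rV[algC]_n.+1) : R :=
  let: existT L (existT _ (exist2 s _ _)) :=
    num_field_exists [seq x 0 i | i <- enum 'I_n.+1] in
  field_height (fun i : 'I_n.+1 => s`_i).

End Height.

Definition homogeneous (F : fieldType) (m d : nat) (p : mpoly m F) : Prop :=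
  p \is ishomog1 d (@mdeg m).

(* The coprimality condition excludes that all the coordinates are 0. *)
Record rational_map (K : fieldType) (n : nat) := RationalMap {
  coordinate : 'I_n.+1 -> mpoly n.+1 K;
  degree : nat;
  coordinate_homogeneous : forall i, homogeneous degree (coordinate i);
  no_common_factor : forall (g : mpoly n.+1 K) (q : 'I_n.+1 -> mpoly n.+1 K),
    (forall i, coordinate i = g * q i) -> g \is a GRing.unit
}.

Definition value_at (n : nat) (p : mpoly n.+1 algC) (x : 'rV[algC]_n.+1) : algC :=
  meval (fun i => x 0 i) p.

(* Any set of homogeneous forms is allowed in place of a finite one; by
   Noetherianity this gives the same open sets. *)
Definition zariski_open (n : nat) (U : set 'rV[algC]_n.+1) : Prop :=
  exists S : set (mpoly n.+1 algC),
    (forall p, S p -> exists e, homogeneous e p) /\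
    U = [set x | x != 0 /\ exists2 p, S p & value_at p x != 0].

Section RationalMaps.
Variables (K : fieldType) (iota : {rmorphism K -> algC}) (n : nat).
Variable f : rational_map K n.

Definition coordinateC (i : 'I_n.+1) : mpoly n.+1 algC :=
  map_mpoly iota (coordinate f i).

Definition indeterminacy_locus : set 'rV[algC]_n.+1 :=
  [set x | x != 0 /\ forall i, value_at (coordinateC i) x = 0].

Definition image_point (x : 'rV[algC]_n.+1) : 'rV[algC]_n.+1 :=
  \row_i value_at (coordinateC i) x.

(* Near x, the map is given by forms g_0, ..., g_n of the same degree that do
   not all vanish at x; the equations f_i g_j = f_j g_i say that
   [g_0, ..., g_n] and [f_0, ..., f_n] are the same rational map. *)
Definition regular_at (x : 'rV[algC]_n.+1) : Prop :=
  exists (e : nat) (g : 'I_n.+1 -> mpoly n.+1 algC),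
    [/\ forall i, homogeneous e (g i),
        forall i j, coordinateC i * g j = coordinateC j * g i &
        exists i, value_at (g i) x != 0].

Definition is_morphism : Prop := forall x, x != 0 -> regular_at x.

End RationalMaps.

(* Main.v *)
Require Import Defs.
From HB Require Import structures.
From mathcomp Require Import all_boot all_order all_algebra all_field.
From mathcomp Require Import all_classical all_reals exp.
From mathcomp Require Import complex.
From mathcomp Require Import -(notations) mpoly.
From mathcomp Require Import ring zify.

(** A line through an indeterminacy point lowers the degree.  Suppose that all
    the forms f_i, of degree d, vanish at the point [b], and join [b] to a point
    of U outside I(f) by the line P_t = a + t b, on which [b] is the point at
    infinity.  The coefficient of t^d in f_i(a + t b) is f_i(b) = 0
    (restrict_to_line_homogeneous), so f is given on this line by polynomials
    in t of degree at most d - 1, and for natural numbers N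
        h(f(P_N)) <= (d - 1) log N + O(1)   and   h(P_N) >= log N - O(1).
    For all large N the point P_N lies in U and outside I(f), so the hypothesis
    gives log N <= O(1), which is absurd.

    Both estimates are made place by place on explicit coordinates in a fixed
    number field L (field_height_upper, field_height_lower).  The archimedean
    part is a sum over the embeddings of L, of which there are exactly
    [L : Q] (embedding_enum), so that log N comes out with the right factor.
    The finite part is bounded independently of N, because |N|_v <= 1.  For the
    lower bound the line is normalised by a_j = 0, b_j = 1 and a_i <> 0: then the
    j-th coordinate of P_N is N, and a_i is a combination of the i-th and j-th
    coordinates of P_N with coefficients independent of N.  These comparisons of
    sums over all finite places make sense only if the supports are finite, a
    sum of infinite support being 0 by convention.  So one has to know that a
    nonzero element of L is a unit at almost all finite places
    (finite_place_neq1), which reduces to the fact that at most [L : Q] finite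
    places lie above a prime p (place_count_le): a family of elements, each large
    at one of these places and small at the others, is linearly independent over
    the rationals.

    The height of a point is computed in the field generated by its
    coordinates, which a priori varies with N.  But polynomials whose coefficients
    generate L take, at all large N, values that generate L (near_nat_generate),
    for distinct embeddings of L are already distinguished by these values; and
    the height can be computed in any field generated by the coordinates
    (weil_heightE). *)

Set Implicit Arguments.
Unset Strict Implicit.
Unset Printing Implicit Defensive.

Import Order.TTheory GRing.Theory Num.Theory.
Local Open Scope classical_set_scope.
Local Open Scope ring_scope.

(** * Embeddings of a number field *)

Lemma pchar0_number_field (L : fieldExtType rat) : [pchar L] =i pred0.
Proof. by move=> p; rewrite pchar_lalg pchar_num. Qed.

Lemma number_field_primitive (L : fieldExtType rat) (M : {subfield L}) :
  exists2 z, z \in M & <<1; z>>%VS = M :> {vspace L}.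
Proof.
have sep : separable 1%AS M.
  by apply/allP => x _; apply/pcharf0_separable/pchar0_number_field.
exists (separable_generator 1%AS M); first exact: separable_generator_mem.
by rewrite -(eq_adjoin_separable_generator sep (sub1v _)).
Qed.

Section Embeddings.
Variables (L : fieldExtType rat) (C : numClosedFieldType).

Let evalL (z : L) (p : {poly rat}) := (map_poly (in_alg L) p).[z].
Let evalC (w : C) (p : {poly rat}) := (map_poly ratr p).[w].

(** The field L is Q[X] modulo the polynomials that vanish at its generator z, so
    p(z) |-> p(w) is well defined as soon as these polynomials vanish at w. *)
Lemma embedding_exists (z : L) (w : C) :
    <<1; z>>%VS = fullv ->
    (forall p : {poly rat}, (map_poly (in_alg L) p).[z] = 0 -> (map_poly ratr p).[w] = 0) ->
  exists s : {rmorphism L -> C}, s z = w.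
Proof.
move=> genz vanish.
have evalLB p q : evalL z (p - q) = evalL z p - evalL z q.
  by rewrite /evalL rmorphB hornerD hornerN.
have evalCB p q : evalC w (p - q) = evalC w p - evalC w q.
  by rewrite /evalC rmorphB hornerD hornerN.
have evalE p q : evalL z p = evalL z q -> evalC w p = evalC w q.
  move=> pq; apply/eqP; rewrite -subr_eq0 -evalCB; apply/eqP/vanish.
  by rewrite -/(evalL _ _) evalLB pq subrr.
have repr (x : L) : {p : {poly rat} | evalL z p = x}.
  apply: cid.
  have xz : x \in <<1; z>>%VS by rewrite genz memvf.
  have /polyOver1P[p Dp] := Fadjoin_polyOver 1%AS z x.
  by exists p; rewrite /evalL -Dp Fadjoin_poly_eq.
pose s x := evalC w (sval (repr x)).
have sE p : s (evalL z p) = evalC w p by rewrite /s; apply: evalE; case: (repr _).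
have sB : zmod_morphism s.
  move=> x y; have [p <-] := repr x; have [q <-] := repr y.
  by rewrite -evalLB !sE evalCB.
have sM : monoid_morphism s.
  split; first by rewrite -[1](_ : evalL z 1 = 1) ?sE /evalL /evalC rmorph1 hornerC.
  move=> x y; have [p <-] := repr x; have [q <-] := repr y.
  rewrite -[X in s X](_ : evalL z (p * q) = _) ?sE.
    by rewrite /evalC rmorphM hornerM.
  by rewrite /evalL rmorphM hornerM.
pose sZ := GRing.isZmodMorphism.Build _ _ s sB.
pose sX := GRing.isMonoidMorphism.Build _ _ s sM.
pose S : {rmorphism L -> C} := HB.pack s sZ sX.
exists S; rewrite /= -[z in LHS](_ : evalL z 'X = z).
  by rewrite sE /evalC map_polyX hornerX.
by rewrite /evalL map_polyX hornerX.
Qed.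

(** The embeddings of L = Q(z) correspond to the roots in C of the minimal
    polynomial of z.  They are simple, in characteristic 0, so their number is
    the degree of z, that is [L : Q]. *)
Lemma embedding_enum : exists emb : 'I_(\dim {:L}) -> {rmorphism L -> C},
  (forall i j, emb i =1 emb j -> i = j) /\
  forall s : {rmorphism L -> C}, exists i, s =1 emb i.
Proof.
have [z _ genz] := number_field_primitive {:L}%AS.
have /polyOver1P[m Dm] := minPolyOver 1%AS z.
have sep : separable_poly m.
  have := pcharf0_separable 1%AS (@pchar0_number_field L) z.
  by rewrite /separable_element Dm separable_map.
have monm : map_poly (ratr : rat -> C) m \is monic.
  by rewrite map_monic -(map_monic (in_alg L)) -Dm monic_minPoly.
have [rs Drs] := closed_field_poly_normal (map_poly (ratr : rat -> C) m).
rewrite (monicP monm) scale1r in Drs.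
have szrs : size rs = \dim {:L}.
  have := size_minPoly 1%AS z.
  rewrite Dm size_map_poly -(size_map_poly (ratr : {rmorphism rat -> C})) Drs.
  rewrite size_prod_XsubC => -[->].
  have := dim_Fadjoin 1%AS z; rewrite /= dimv1 muln1 => <-.
  by rewrite genz.
have urs : uniq rs.
  by rewrite -separable_prod_XsubC -Drs separable_map.
have mroot w : (w \in rs) = ((map_poly (ratr : rat -> C) m).[w] == 0).
  by rewrite Drs -root_prod_XsubC.
have ex (i : 'I_(\dim {:L})) : {s : {rmorphism L -> C} | s z = rs`_i}.
  apply/cid/embedding_exists => // p pz0.
  have : map_poly (in_alg L) m %| map_poly (in_alg L) p.
    rewrite -Dm; apply: minPoly_dvdp; last exact/rootP.
    by apply/polyOver1P; exists p.
  rewrite dvdp_map => /dvdpP[q ->]; rewrite rmorphM hornerM.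
  suff /eqP -> : (map_poly (ratr : rat -> C) m).[rs`_i] == 0 by rewrite mulr0.
  by rewrite -mroot mem_nth // szrs.
exists (fun i => sval (ex i)); split.
  move=> i j /(_ z); case: (ex i) => si /= ->; case: (ex j) => sj /= -> /eqP.
  by rewrite nth_uniq ?szrs // => /eqP /val_inj.
move=> s.
have szin : s z \in rs.
  rewrite mroot -[X in X == _](_ : s (map_poly (in_alg L) m).[z] = _).
    by rewrite -Dm minPolyxx rmorph0.
  rewrite -horner_map -map_poly_comp; congr _.[_]; apply: eq_map_poly => a /=.
  by rewrite alg_num_field fmorph_rat.
have ltsz : (index (s z) rs < \dim {:L})%N by rewrite -szrs index_mem.
exists (Ordinal ltsz) => x; case: (ex _) => t /= tz.
have xz : x \in <<1; z>>%VS by rewrite genz memvf.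
have /polyOver1P[p Dp] := Fadjoin_polyOver 1%AS z x.
have := Fadjoin_poly_eq xz; rewrite Dp => <-.
rewrite -!horner_map -!map_poly_comp tz nth_index //; congr _.[_].
by apply: eq_map_poly => a /=; rewrite alg_num_field !fmorph_rat.
Qed.

End Embeddings.

(** * Finite places *)

Lemma expr_gt_bound (R : realType) (a b : R) : 1 < a -> exists m, b < a ^+ m.
Proof.
move=> a1; have e0 : 0 < a - 1 by rewrite subr_gt0.
have bern m : 1 + m%:R * (a - 1) <= a ^+ m.
  elim: m => [|m IH]; first by rewrite mul0r addr0 expr0.
  have a0 : 0 <= a by rewrite ltW // (lt_trans ltr01).
  rewrite exprS; apply: le_trans (ler_wpM2l a0 IH).
  have -> : a * (1 + m%:R * (a - 1)) = 1 + m.+1%:R * (a - 1) + m%:R * (a - 1) ^+ 2.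
    by rewrite -natr1; ring.
  by rewrite lerDl mulr_ge0 ?ler0n ?exprn_ge0 ?(ltW e0).
have [b0|b0] := leP b 0; first by exists 0%N; rewrite expr0 (le_lt_trans b0).
exists (Num.Def.archi_bound (b / (a - 1))).
apply: lt_le_trans (bern _); rewrite addrC ltr_wpDr // -ltr_pdivrMr //.
by apply/archi_boundP; rewrite divr_ge0 // ltW.
Qed.

(** Used with b = v y to absorb a fixed factor into a high power. *)
Lemma expr_lt_bound (R : realType) (a b : R) :
  0 <= a -> a < 1 -> exists M, forall m, (M <= m)%N -> a ^+ m * b < 1.
Proof.
move=> a0 a1; have [->|a_neq0] := eqVneq a 0.
  by exists 1%N => -[//|m] _; rewrite exprS !mul0r.
have apos : 0 < a by rewrite lt_def a_neq0.
have [M HM] : exists M, b < a^-1 ^+ M by apply: expr_gt_bound; rewrite invf_gt1.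
exists M => m le_Mm; have [b0|b0] := leP b 0.
  by rewrite (le_lt_trans _ ltr01) // mulr_ge0_le0 ?exprn_ge0.
rewrite -ltr_pdivlMl ?exprn_gt0 // mulr1 -exprVn (lt_le_trans HM) //.
by rewrite ler_weXn2l // ltW // invf_gt1.
Qed.

Section FinitePlace.
Variables (R : realType) (L : fieldExtType rat).
Implicit Types (v w : L -> R) (x y : L).

Section Place.
Variables (v : L -> R) (hv : finite_place v).

Lemma place0 : v 0 = 0. Proof. by case: hv. Qed.

Lemma placeM x y : v (x * y) = v x * v y. Proof. by case: hv. Qed.

Lemma placeD x y : v (x + y) <= Num.max (v x) (v y). Proof. by case: hv. Qed.

Lemma place_value x : x != 0 ->
  exists2 q : nat, range (fun k : int => (q%:R : R) ^ k) = v @` [set x | x != 0] &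
  exists k : int, v x = q%:R ^ k.
Proof.
case: hv => _ _ _ [q [_ vE]] x0; exists q => //.
have : (v @` [set x | x != 0]) (v x) by exists x.
by rewrite vE => -[k _ <-]; exists k.
Qed.

Lemma place1 : v 1 = 1.
Proof.
have [q vE _] := @place_value 1 (oner_neq0 _).
have : (v @` [set x | x != 0]) 1 by rewrite -vE; exists 0; rewrite ?expr0z.
by case=> x x0 vx1; have := placeM 1 x; rewrite mul1r vx1 mulr1.
Qed.

Lemma place_gt0 x : x != 0 -> 0 < v x.
Proof.
move=> x0; have [q _ [k vx]] := place_value x0.
have vx_neq0 : v x != 0.
  apply/eqP => vx0; have := placeM x x^-1; rewrite vx0 mul0r divff // place1.
  by move/eqP; rewrite oner_eq0.
by rewrite lt_def vx_neq0 vx exprz_ge0.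
Qed.

Lemma place_ge0 x : 0 <= v x.
Proof. by have [->|/place_gt0/ltW//] := eqVneq x 0; rewrite place0. Qed.

Lemma placeV x : v x^-1 = (v x)^-1.
Proof.
have [->|x0] := eqVneq x 0; first by rewrite invr0 place0 invr0.
apply: (mulfI (lt0r_neq0 (place_gt0 x0))).
by rewrite -placeM !divff ?place1 // lt0r_neq0 ?place_gt0.
Qed.

Lemma placeX x m : v (x ^+ m) = v x ^+ m.
Proof. by elim: m => [|m IH]; rewrite ?expr0 ?place1 // !exprS placeM IH. Qed.

Lemma placeXz x (k : int) : v (x ^ k) = v x ^ k.
Proof.
by case: k => m; rewrite ?NegzE -?exprnN -?exprnP ?placeV placeX.
Qed.

Lemma placeN x : v (- x) = v x.
Proof.
have v_ge0 := place_ge0.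
apply/eqP; rewrite -(@eqrXn2 _ 2) // -!placeX.
by rewrite sqrrN.
Qed.

Lemma place_add_le x y (b : R) : v x <= b -> v y <= b -> v (x + y) <= b.
Proof. by move=> xb yb; apply: le_trans (placeD x y) _; rewrite ge_max xb. Qed.

Lemma place_add_lt x y (b : R) : v x < b -> v y < b -> v (x + y) < b.
Proof. by move=> xb yb; apply: le_lt_trans (placeD x y) _; rewrite gt_max xb. Qed.

Lemma place_sum_le (I : Type) (r : seq I) (P : pred I) (F : I -> L) (b : R) :
  0 <= b -> (forall i, P i -> v (F i) <= b) -> v (\sum_(i <- r | P i) F i) <= b.
Proof.
move=> b0 Fb; elim/big_ind: _ => //; first by rewrite place0.
by move=> x y; exact: place_add_le.
Qed.

Lemma place_sum_lt (I : Type) (r : seq I) (P : pred I) (F : I -> L) (b : R) :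
  0 < b -> (forall i, P i -> v (F i) < b) -> v (\sum_(i <- r | P i) F i) < b.
Proof.
move=> b0 Fb; elim/big_ind: _ => //; first by rewrite place0.
by move=> x y; exact: place_add_lt.
Qed.

Lemma place_add_eq x y : v x < v y -> v (x + y) = v y.
Proof.
move=> xy; apply/eqP; rewrite eq_le place_add_le ?(ltW xy) //= leNgt.
apply/negP => sy; have : v y < v y; last by rewrite ltxx.
by rewrite -{1}[y](addKr x) addrC place_add_lt ?placeN // addrC.
Qed.

Lemma place_nat m : v m%:R <= 1.
Proof.
elim: m => [|m IH]; first by rewrite place0 ler01.
by rewrite -natr1 place_add_le // place1.
Qed.

Lemma place_int (m : int) : v m%:~R <= 1.
Proof. by case: m => m; rewrite ?NegzE ?mulrNz ?placeN place_nat. Qed.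

(** Bezout: 1 = a p + b m cannot hold if both p and m have absolute value less
    than 1. *)
Lemma place_int_unit p (m : int) :
  prime p -> v p%:R < 1 -> ~~ (p %| `|m|)%N -> v m%:~R = 1.
Proof.
move=> pr_p vp pm; have copm : coprimez p m by rewrite coprimezE prime_coprime.
have /eqP := copm; have [a [b <-]] := Bezoutz p m => ab1.
apply/eqP; rewrite eq_le place_int /= leNgt; apply/negP => vm.
have : v 1 < 1; last by rewrite place1 ltxx.
have -> : (1 : L) = a%:~R * p%:R + b%:~R * m%:~R.
  by rewrite -[p%:R]/(p%:Z%:~R) -!intrM -intrD ab1.
have lt1 (c : int) x : v x < 1 -> v (c%:~R * x) < 1.
  move=> vx; rewrite placeM (le_lt_trans _ vx) //.
  by rewrite ler_piMl ?place_ge0 ?place_int.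
by rewrite place_add_lt ?lt1.
Qed.

End Place.

End FinitePlace.

(** * A finite place is determined by its valuation ring *)

Section Separation.
Variables (R : realType) (L : fieldExtType rat).
Implicit Types (v w : L -> R) (x y : L).

(** Elements in distinct residue classes of v lie in distinct residue classes of w,
    because w x < 1 implies v x < 1; and r and r' list the classes. *)
Lemma residue_count_le v w (q q' : nat) (r : 'I_q -> L) (r' : 'I_q' -> L) :
    finite_place v -> finite_place w ->
    (forall x, v x <= 1 -> w x <= 1) -> (forall x, w x < 1 -> v x < 1) ->
    (forall i, v (r i) <= 1) ->
    (forall x, v x <= 1 -> exists! i, v (x - r i) < 1) ->
    (forall x, w x <= 1 -> exists! i, w (x - r' i) < 1) ->
  (q <= q')%N.
Proof.
move=> hv hw vw wv r1 Hr Hr'.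
have ex i : {j | w (r i - r' j) < 1}.
  by apply: cid; have [j [? _]] := Hr' _ (vw _ (r1 i)); exists j.
rewrite -(card_ord q) -(card_ord q'); apply: (@leq_card _ _ (fun i => sval (ex i))).
move=> i1 i2 /=; case: (ex i1) => j1 /= w1; case: (ex i2) => j2 /= w2 j12.
rewrite -{}j12 in w2.
have [i [_ iu]] := Hr _ (r1 i1); transitivity i; last first.
  apply: iu; rewrite -(subrKA (r' j1)) ; apply: place_add_lt => //; apply: wv => //.
  by rewrite -opprB placeN.
by symmetry; apply: iu; rewrite subrr place0 // ltr01.
Qed.

(** First, if the valuation ring of w is contained in that of v, then they are
    equal: otherwise v x <= 1 < w x for some x, and z^-1 / x^m is for large m
    in the ring of w but not in that of v.  The common ring determines the
    residue field, hence its cardinal q, and the units; and a normalized place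
    is determined by q, the units and the value q^-1 at a uniformizer. *)
Lemma place_eq v w z z' :
    finite_place v -> finite_place w -> z != 0 -> v z < 1 -> z' != 0 -> w z' < 1 ->
    (forall x, w x <= 1 -> v x <= 1) ->
  v = w.
Proof.
move=> hv hw z0 vz z'0 wz' wv.
have vw x : v x <= 1 -> w x <= 1.
  move=> vx; rewrite leNgt; apply/negP => wx.
  have x0 : x != 0 by apply: contraTneq wx => ->; rewrite place0 // -leNgt ler01.
  have [m wzm] := expr_gt_bound (w z)^-1 wx.
  have : v (z^-1 / x ^+ m) <= 1.
    apply: wv; rewrite placeM // !placeV // placeX // ler_pdivrMr ?mul1r ?ltW //.
    by rewrite exprn_gt0 // (lt_trans ltr01).
  rewrite placeM // !placeV // placeX // -invfM invf_le1; last first.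
    by rewrite mulr_gt0 ?exprn_gt0 ?place_gt0.
  rewrite leNgt => /negP; apply; rewrite (le_lt_trans _ vz) //.
  by rewrite ler_piMr ?place_ge0 // exprn_ile1 // place_ge0.
have lt1 (u u' : L -> R) : finite_place u -> finite_place u' ->
    (forall x, u' x <= 1 -> u x <= 1) -> forall x, u x < 1 -> u' x < 1.
  move=> hu hu' uu' x ux; have [->|x0] := eqVneq x 0; first by rewrite place0 // ltr01.
  rewrite ltNge; apply/negP => u'x.
  have : u x^-1 <= 1 by apply: uu'; rewrite placeV // invf_le1 // place_gt0.
  by rewrite placeV // invf_le1 ?place_gt0 // leNgt ux.
case: (hv) => _ _ _ [q [[r [r1 Hr]] vE]]; case: (hw) => _ _ _ [q' [[r' [r1' Hr']] wE]].
have qq' : q = q'.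
  apply/eqP; rewrite eqn_leq.
  rewrite (residue_count_le hv hw vw (lt1 w v hw hv vw) r1 Hr Hr').
  by rewrite (residue_count_le hw hv wv (lt1 v w hv hw wv) r1' Hr' Hr).
subst q'.
have vval x : x != 0 -> exists k : int, v x = q%:R ^ k.
  move=> x0; have : (v @` [set x | x != 0]) (v x) by exists x.
  by rewrite vE => -[k _ <-]; exists k.
have wval x : x != 0 -> exists k : int, w x = q%:R ^ k.
  move=> x0; have : (w @` [set x | x != 0]) (w x) by exists x.
  by rewrite wE => -[k _ <-]; exists k.
have q1 : (1 < q)%N.
  have [k vzk] := vval _ z0; have vz0 := place_gt0 hv z0.
  move: vz vz0; rewrite vzk; case: (q) => [|[|//]].
    by rewrite exp0rz; case: eqP; rewrite ltxx.
  by rewrite exp1rz ltxx.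
have qR0 : (0 : R) < q%:R by rewrite ltr0n ltnW.
have qR1 : (q%:R : R) != 1 by rewrite gt_eqF // ltr1n.
(* A uniformizer for v; the steps below show that it is one for w. *)
have [pi pi0 vpi] : exists2 pi, pi != 0 & v pi = q%:R ^ (- 1).
  have : (v @` [set x | x != 0]) (q%:R ^ (- 1)) by rewrite vE; exists (-1).
  by case=> pi pi0 <-; exists pi.
have eq1 x : v x = 1 -> w x = 1.
  move=> vx; apply/eqP; rewrite eq_le vw ?vx //=.
  have x0 : x != 0.
    by apply: contra_eq_neq vx => ->; rewrite place0 // eq_sym oner_neq0.
  have : w x^-1 <= 1 by apply: vw; rewrite placeV // vx invr1.
  by rewrite placeV // invf_le1 // place_gt0.
have wpiE x k : v x = q%:R ^ k -> w x = w pi ^ (- k).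
  move=> vx; have : w (x * pi ^ k) = 1.
    apply: eq1; rewrite placeM // placeXz // vx vpi exprz_exp mulN1r.
    by rewrite -expfzDr ?gt_eqF // subrr expr0z.
  rewrite placeM // placeXz // => wx1.
  by apply: (mulIf (expfz_neq0 k (lt0r_neq0 (place_gt0 hw pi0)))); rewrite wx1
     -expfzDr ?gt_eqF ?place_gt0 // addNr expr0z.
have wpi : w pi = q%:R ^ (- 1).
  have [j wpij] := wval _ pi0.
  have [y y0 wy] : exists2 y, y != 0 & w y = q%:R ^ (- 1).
    have : (w @` [set x | x != 0]) (q%:R ^ (- 1)) by rewrite wE; exists (-1).
    by case=> y y0 <-; exists y.
  have [k vy] := vval _ y0.
  have := wpiE _ _ vy; rewrite wy wpij exprz_exp => /(ieexprIz qR0 qR1) jk.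
  have wpi1 : w pi < 1.
    apply: (lt1 v w) => //; rewrite vpi exprN1 invf_lt1 //.
    by rewrite ltr1n.
  have j0 : j < 0.
    rewrite ltNge; apply/negP => j0; move: wpi1; rewrite wpij ltNge.
    by rewrite -(gez0_abs j0) -exprnP exprn_ege1 // ler1n ltnW.
  (* Here - 1 = j * - k with j < 0, which leaves only j = - 1. *)
  have k0 : k < 0 by nia.
  have [j1|] : j <= - 2 \/ j = - 1 by lia.
    have : 1 = j * k by rewrite -[1]opprK jk mulrN opprK.
    nia.
  by move->.
apply/funext => x; have [->|x0] := eqVneq x 0; first by rewrite !place0.
have [k vx] := vval _ x0.
by rewrite (wpiE _ _ vx) vx wpi exprz_exp mulrNN mul1r.
Qed.
End Separation.

(** * Finiteness of the set of places above a prime *)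

Section Finiteness.
Variables (R : realType) (L : fieldExtType rat).
Implicit Types (v w : L -> R) (x y : L).

Definition place_above (p : nat) (v : L -> R) := finite_place v /\ v p%:R < 1.

Lemma natr_neq0 p : (0 < p)%N -> (p%:R : L) != 0.
Proof.
move=> p0; rewrite -(rmorph_nat (in_alg L)) fmorph_eq0 pnatr_eq0 -lt0n //.
Qed.

(** By place_eq neither valuation ring contains the other: divide an element that
    is only in the ring of w by an element that is only in the ring of v. *)
Lemma place_separation p v w : (0 < p)%N -> place_above p v -> place_above p w -> v <> w ->
  exists x, 1 < v x /\ w x < 1.
Proof.
move=> p0 [hv vp] [hw wp] vw; have pn := natr_neq0 p0.
have strict (u u' : L -> R) : finite_place u -> finite_place u' -> u p%:R < 1 -> u' p%:R < 1 ->
    u <> u' -> exists x, 1 < u x /\ u' x <= 1.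
  move=> hu hu' up u'p uu'; apply: contrapT => nex; apply: uu'.
  apply: (place_eq hu hu' pn up pn u'p) => x u'x; rewrite leNgt.
  by apply/negP => ux; apply: nex; exists x.
have [x [vx wx]] := strict _ _ hv hw vp wp vw.
have [y [wy vy]] := strict _ _ hw hv wp vp (nesym vw).
have y0 : y != 0 by apply: contraTneq wy => ->; rewrite place0 // -leNgt ler01.
exists (x / y); rewrite !placeM // !placeV //; split.
  by rewrite ltr_pdivlMr ?place_gt0 // mul1r (le_lt_trans vy).
by rewrite ltr_pdivrMr ?place_gt0 // mul1r (le_lt_trans wx).
Qed.

(** Weak approximation.  To include a further place w, correct x by an element y
    that is large at v and small at w: if w x <= 1, then x^m y works for large
    m; if w x > 1, then x^m y / (1 + x^m) does, since the quotient
    x^m / (1 + x^m) has absolute value exactly 1 at v and w. *)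
Lemma place_approximation p v (s : seq (L -> R)) :
    (0 < p)%N -> place_above p v -> (forall w, w \in s -> place_above p w /\ v <> w) ->
  exists x, 1 < v x /\ forall w, w \in s -> w x < 1.
Proof.
move=> p0 pv; have [hv vp] := pv; elim: s => [|w s IH] Hs.
  exists p%:R^-1; split=> //; rewrite placeV // invf_gt1 // place_gt0 //.
  exact: natr_neq0.
have [|x [vx sx]] := IH; first by move=> u us; apply: Hs; rewrite inE us orbT.
have [pw vw] : place_above p w /\ v <> w by apply: Hs; rewrite inE eqxx.
have [hw wp] := pw; have [y [vy wy]] := place_separation p0 pv pw vw.
have place_s u : u \in s -> finite_place u.
  by move=> us; have [|[]] := Hs u; rewrite // inE us orbT.
(* One exponent that makes x^m y small at all the places of s. *)
have [M HM] : exists M, forall m, (M <= m)%N -> forall u, u \in s -> u x ^+ m * u y < 1.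
  elim: s sx place_s {IH Hs} => [|u s IH] sx place_s; first by exists 0%N.
  have [||M HM] := IH.
  - by move=> u' us; apply: sx; rewrite inE us orbT.
  - by move=> u' us; apply: place_s; rewrite inE us orbT.
  have hu : finite_place u by apply: place_s; rewrite inE eqxx.
  have [M' HM'] := expr_lt_bound (u y) (place_ge0 hu x) (sx u (mem_head _ _)).
  exists (maxn M M') => m; rewrite geq_max => /andP[le1 le2] u'.
  by rewrite inE => /predU1P[->|/HM]; [exact: HM'|apply].
have M1 : (M <= M.+1)%N by [].
have [wx|wx] := leP (w x) 1.
  exists (x ^+ M.+1 * y); split.
    by rewrite placeM // placeX // mulr_egt1 // exprn_egt1.
  move=> u; rewrite inE => /predU1P[->|us].
    rewrite placeM // placeX // (le_lt_trans _ wy) // ler_piMl ?place_ge0 //.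
    by rewrite exprn_ile1 // place_ge0.
  have hu := place_s u us.
  by rewrite placeM // placeX // HM.
have big1 u : finite_place u -> 1 < u x -> u (x ^+ M.+1 / (1 + x ^+ M.+1)) = 1.
  move=> hu ux; have uxM : 1 < u x ^+ M.+1 by rewrite exprn_egt1.
  rewrite placeM // placeV // place_add_eq // !placeX ?place1 //.
  by rewrite divff // gt_eqF // (lt_trans ltr01).
exists (x ^+ M.+1 / (1 + x ^+ M.+1) * y); split; first by rewrite placeM // big1 // mul1r.
move=> u; rewrite inE => /predU1P[->|us]; first by rewrite placeM // big1 // mul1r.
have hu := place_s u us.
have uxM : u x ^+ M.+1 < 1 by rewrite exprn_ilt1 ?place_ge0 // sx.
rewrite placeM // placeM // placeV // addrC place_add_eq // placeX // ?place1 //.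
by rewrite invr1 mulr1 HM.
Qed.

(** All the places above p induce the same valuation ring on the rationals, the
    localization of the integers at p. *)
Lemma place_rat_le p v w (c : rat) : prime p -> place_above p v -> place_above p w ->
  v c%:A <= 1 -> w c%:A <= 1.
Proof.
move=> pr_p [hv vp] [hw wp].
have -> : c%:A = (numq c)%:~R / (denq c)%:~R :> L.
  by rewrite -in_algE -[in LHS](divq_num_den c) fmorph_div !rmorph_int.
rewrite !placeM // !placeV // => vc.
have [pd|npd] := boolP (p %| `|denq c|)%N; last first.
  by rewrite (place_int_unit hw pr_p wp npd) invr1 mulr1 place_int.
have npn : ~~ (p %| `|numq c|)%N.
  by rewrite -prime_coprime // (coprime_dvdl pd) // coprime_sym coprime_num_den.
move: vc; rewrite (place_int_unit hv pr_p vp npn) mul1r.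
have d0 : ((denq c)%:~R : L) != 0.
  by rewrite -(rmorph_int (in_alg L)) fmorph_eq0 intr_eq0 denq_neq0.
rewrite invf_le1 ?place_gt0 // leNgt => /negP[].
have /dvdnP[k dk] := pd.
have -> : (denq c)%:~R = (k%:R * p%:R : L).
  by rewrite -natrM -dk -[in LHS](gez0_abs (denq_ge0 c)).
by rewrite placeM // (le_lt_trans _ vp) // ler_piMl ?place_ge0 // place_nat.
Qed.

(** Choose x_i with v_i x_i > 1 and v_j x_i < 1 for j <> i.  In a nontrivial
    rational relation between the x_i, let c_i be a coefficient of maximal p-adic
    absolute value, which by place_rat_le is the same notion for all the v_i.
    Then c_i x_i strictly dominates the other terms at v_i.  So the x_i are
    linearly independent over the rationals. *)
Lemma place_count_le p k (P : k.-tuple (L -> R)) : prime p -> uniq P ->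
  (forall v, v \in P -> place_above p v) -> (k <= \dim {:L})%N.
Proof.
move=> pr_p uP aP; have p0 := prime_gt0 pr_p.
have ex i : {x | 1 < tnth P i x /\ forall j, j != i -> tnth P j x < 1}.
  apply: cid; have [||x [vx Hx]] := @place_approximation p (tnth P i) (rem (tnth P i) P) p0.
  - exact/aP/mem_tnth.
  - move=> w; rewrite mem_rem_uniq // inE => /andP[/eqP wi wP].
    by split; [exact: aP | exact: nesym].
  exists x; split=> // j ji; apply: Hx; rewrite mem_rem_uniq // inE mem_tnth andbT.
  by rewrite !(tnth_nth (fun=> 0)) nth_uniq ?size_tuple.
pose X := [tuple sval (ex i) | i < k].
suff /eqP : free X by rewrite size_tuple => <-; rewrite dimvS // subvf.
apply/freeP => c c0 i0; apply/eqP; apply: contraT => ci0.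
have ap i : place_above p (tnth P i) by exact/aP/mem_tnth.
have hp i : finite_place (tnth P i) by case: (ap i).
(* Any of the places can be used to compare the coefficients. *)
pose F i := tnth P i0 (c i)%:A.
case: (@arg_maxP _ _ _ i0 xpredT F isT) => i _ imax0; have imax j : F j <= F i := imax0 j isT.
have cA j : ((c j)%:A == 0 :> L) = (c j == 0) by rewrite -in_algE fmorph_eq0.
have ci : (c i)%:A != 0 :> L.
  apply/eqP => ci; have := imax i0; rewrite /F ci place0 // leNgt.
  by rewrite place_gt0 // cA.
have le_ci j : tnth P i (c j)%:A <= tnth P i (c i)%:A.
  have : tnth P i0 (c j / c i)%:A <= 1.
    rewrite -!in_algE fmorph_div /= placeM // placeV // ler_pdivrMr ?mul1r ?place_gt0 //.
    exact: imax.
  move/(place_rat_le pr_p (ap i0) (ap i)).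
  rewrite -!in_algE fmorph_div /= placeM // placeV //.
  by rewrite ler_pdivrMr ?mul1r ?place_gt0.
pose v := tnth P i; have hv : finite_place v by exact: hp.
move: c0; rewrite (bigD1 i) // => /eqP; rewrite addr_eq0 => /eqP ciE.
have Xi (j : 'I_k) : X`_j = sval (ex j) by rewrite -tnth_nth tnth_mktuple.
have vi : v (c i)%:A < v (c i *: X`_i).
  rewrite -(mulr_algl _ X`_i) placeM // ltr_pMr ?place_gt0 // Xi.
  by case: (ex i) => x [].
suff : v (c i *: X`_i) < v (c i *: X`_i) by rewrite ltxx.
rewrite {1}ciE placeN // place_sum_lt // ?(le_lt_trans _ vi) ?place_ge0 // => j ji.
apply: le_lt_trans vi; apply: le_trans (le_ci j).
rewrite -(mulr_algl _ X`_j) placeM // ler_piMr ?place_ge0 // Xi ltW //.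
by case: (ex j) => x /= [_ ->] //; rewrite eq_sym.
Qed.

Lemma finite_place_above p : prime p -> finite_set [set v | place_above p v].
Proof.
move=> pr_p; apply: contrapT => /(infinite_set_fset (\dim {:L}).+1)[B BA szB].
move: szB; rewrite ltnNge => /negP[].
apply: (@place_count_le p _ (in_tuple (finmap.enum_fset B)) pr_p).
  exact: finmap.fset_uniq.
by move=> v vB; exact: BA.
Qed.

Lemma place_prime_divisor v (m : nat) : finite_place v -> (0 < m)%N -> v m%:R < 1 ->
  exists2 p, p \in primes m & v p%:R < 1.
Proof.
move=> hv; have [n] := ubnP m; elim: n m => // n IH m lt_mn m0 vm.
have m1 : (1 < m)%N.
  by case: m m0 vm {lt_mn} => [|[|//]] // _; rewrite place1 // ltxx.
have /dvdnP[k mE] := pdiv_dvd m; have pr_p := pdiv_prime m1.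
have pm : pdiv m \in primes m by rewrite mem_primes pr_p m0 pdiv_dvd.
have [vp|vp] := ltP (v (pdiv m)%:R) 1; first by exists (pdiv m).
have k0 : (0 < k)%N by move: m0; rewrite mE; case: (k).
have [||p pk vpk] := IH k _ k0; last first.
- exists p => //; move: pk; rewrite !mem_primes m0 k0 /= => /andP[-> pk].
  by rewrite mE dvdn_mulr.
- rewrite ltNge; apply/negP => vk; move: vm; rewrite mE natrM placeM // ltNge => /negP[].
  by rewrite mulr_ege1.
- rewrite -ltnS; apply: leq_trans lt_mn; rewrite ltnS mE ltn_Pmulr // prime_gt1 //.
Qed.

Lemma finite_place_nat_lt1 (m : nat) : (0 < m)%N ->
  finite_set [set v : L -> R | finite_place v /\ v m%:R < 1].
Proof.
move=> m0; apply: (@sub_finite_set _ _ (\bigcup_(p in [set` primes m]) [set v | place_above p v])).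
  by move=> v [hv vm]; have [p pm vp] := place_prime_divisor hv m0 vm; exists p.
apply: bigcup_finite => // p; rewrite /= mem_primes => /andP[pr_p _].
exact: finite_place_above.
Qed.
End Finiteness.

(** * The places where an element is not a unit *)

Section Support.
Variables (R : realType) (L : fieldExtType rat).
Implicit Types (v w : L -> R) (x y : L).

(** If v y > 1, then the leading term of p(y) dominates all the others. *)
Lemma place_integral v (p : {poly L}) y : finite_place v ->
  p \is monic -> root p y -> (forall i, v p`_i <= 1) -> v y <= 1.
Proof.
move=> hv monp /rootP py0 pi1; rewrite leNgt; apply/negP => vy.
have szp : size p = (size p).-1.+1 by rewrite prednK // lt0n size_poly_eq0 monic_neq0.
set n := (size p).-1 in szp.
have vy0 : 0 < v y by exact: lt_trans ltr01 vy.
move: py0; rewrite horner_coef szp big_ord_recr /= -lead_coefE (monicP monp) mul1r.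
move/eqP; rewrite addrC addr_eq0 => /eqP yn.
have : v (y ^+ n) < v (y ^+ n); last by rewrite ltxx.
rewrite [X in v X < _]yn placeN // place_sum_lt // ?placeX ?exprn_gt0 // => i _.
rewrite placeM // placeX // (le_lt_trans (ler_piMl _ (pi1 _))) ?exprn_ge0 ?ltW //.
by rewrite ltr_eXn2l.
Qed.

(** If v y > 1, then some coefficient of the minimal polynomial of y has absolute
    value greater than 1, so its denominator has absolute value less than 1. *)
Lemma finite_place_gt1 y : finite_set [set v : L -> R | finite_place v /\ 1 < v y].
Proof.
have /polyOver1P[p Dp] := minPolyOver 1%AS y.
pose den i := `|denq p`_i|%N.
apply: (@sub_finite_set _ _ (\bigcup_(i in `I_(size p))
    [set v | finite_place v /\ v (den i)%:R < 1])).
  move=> v [hv vy]; apply: contrapT => nbig.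
  move: vy; rewrite ltNge => /negP; apply.
  apply: (place_integral hv (monic_minPoly 1%AS y) (root_minPoly 1%AS y)) => i.
  rewrite Dp coef_map /= -(divq_num_den p`_i) -in_algE fmorph_div !rmorph_int.
  have [le_pi|lt_ip] := leqP (size p) i.
    by rewrite nth_default // mul0r place0 // ler01.
  have den1 : v (denq p`_i)%:~R = 1.
    apply/eqP; rewrite eq_le place_int // leNgt /=; apply/negP => vd; apply: nbig.
    exists i => //=; split=> //; move: vd.
    by rewrite -[in X in X -> _](gez0_abs (denq_ge0 p`_i)).
  by rewrite placeM // placeV // den1 invr1 mulr1 place_int.
apply: bigcup_finite; first exact: finite_II.
by move=> i _; apply: finite_place_nat_lt1; rewrite absz_gt0 denq_neq0.
Qed.

Lemma finite_place_neq1 y : y != 0 ->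
  finite_set [set v : L -> R | finite_place v /\ v y != 1].
Proof.
move=> y0; apply: (@sub_finite_set _ _ ([set v | finite_place v /\ 1 < v y] `|`
   [set v | finite_place v /\ 1 < v y^-1])).
  move=> v [hv]; rewrite neq_lt => /orP[vy|vy]; last by left.
  by right; split=> //; rewrite placeV // invf_gt1 // place_gt0.
by rewrite finite_setU; split; exact: finite_place_gt1.
Qed.

(** Outside a finite set of places all the nonzero y_i are units, so that the
    maximum is 1, or 0 if all the y_i are 0; in both cases its logarithm is 0. *)
Lemma finite_support_ln_place (I : finType) (y : I -> L) :
  finite_set [set v : L -> R | finite_place v /\ ln (\big[Num.max/0]_i v (y i)) != 0].
Proof.
apply: (@sub_finite_set _ _ (\bigcup_(i in [set i | y i != 0])
    [set v | finite_place v /\ v (y i) != 1])).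
  move=> v [hv]; apply: contra_neqP => nbig.
  have vi i : v (y i) = (y i != 0)%:R.
    have [->|yi] := eqVneq (y i) 0; first by rewrite place0.
    by apply: contrapT => /eqP vyi; apply: nbig; exists i.
  have [/existsP[i yi]|/existsPn y0] := boolP [exists i, y i != 0].
    rewrite (_ : \big[_/_]_i _ = 1) ?ln1 //; apply/eqP; rewrite eq_le.
    apply/andP; split; last first.
      by rewrite (bigmax_sup i) // vi yi.
    by apply/bigmax_leP; split=> // j _; rewrite vi; case: (_ != _).
  rewrite (_ : \big[_/_]_i _ = 0) ?ln0 //; apply/eqP; rewrite eq_le.
  apply/andP; split; last exact: bigmax_ge_id.
  by apply/bigmax_leP; split=> // j _; rewrite vi (negbTE (y0 j)).
apply: bigcup_finite => [|i /= yi]; last exact: finite_place_neq1.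
exact: finite_finset.
Qed.

End Support.

(** * Height estimates in a fixed number field *)

(** The lower argument may be nonpositive, where ln is 0. *)
Lemma ler_ln_ge1 (R : realType) (x y : R) : 1 <= y -> x <= y -> ln x <= ln y.
Proof.
move=> y1 xy; have [x0|x0] := leP x 0; first by rewrite ln0 // ln_ge0.
by rewrite ler_ln // posrE ?(lt_le_trans ltr01).
Qed.

(** All three sums can be taken over the finite union of the three supports. *)
Lemma ler_fsum_add (R : realType) (T : choiceType) (A : set T) (F G H : T -> R) :
    finite_set [set x | A x /\ F x != 0] -> finite_set [set x | A x /\ G x != 0] ->
    finite_set [set x | A x /\ H x != 0] ->
    (forall x, A x -> F x <= G x + H x) ->
  \sum_(x \in A) F x <= \sum_(x \in A) G x + \sum_(x \in A) H x.
Proof.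
set SF := [set x | _]; set SG := [set x | A x /\ G x != 0]; set SH := [set x | _ /\ H x != 0].
move=> finF finG finH FGH; pose B := SF `|` SG `|` SH.
have finB : finite_set B by rewrite !finite_setU.
have BA : B `<=` A by move=> x [[[]|[]]|[]].
have widen (K : T -> R) : (forall x, A x -> K x != 0 -> B x) ->
    \sum_(x \in A) K x = \sum_(x <- finmap.enum_fset (fset_set B)) K x.
  move=> KB; rewrite -fsbig_finite //; apply/esym/fsbig_widen => // x [Ax nBx].
  by apply/eqP; apply: contrapT => /negP /(KB _ Ax).
rewrite !widen.
- rewrite -big_split /= big_seq [leRHS]big_seq; apply: ler_sum => x.
  by rewrite in_fset_set // inE => /BA /FGH.
- by move=> x Ax Hx; right.
- by move=> x Ax Gx; left; right.
- by move=> x Ax Fx; left; left.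
Qed.

Section Normc.
Variable R : realType.
Implicit Types x y : R[i].

Lemma normc_nat N : Normc.normc (N%:R : R[i]) = N%:R.
Proof. by rewrite normcMn Normc.normc1. Qed.

Lemma normc_ge0 x : 0 <= Normc.normc x.
Proof. by case: x => a b; rewrite /= sqrtr_ge0. Qed.

Lemma normc_sum (I : Type) (r : seq I) (P : pred I) (F : I -> R[i]) :
  Normc.normc (\sum_(i <- r | P i) F i) <= \sum_(i <- r | P i) Normc.normc (F i).
Proof.
elim/big_ind2: _ => // [|x1 y1 x2 y2 le1 le2]; first by rewrite Normc.normc0.
by apply: le_trans (le_normcD _ _) _; exact: lerD.
Qed.

End Normc.

Section HeightBounds.
Variables (R : realType) (L : fieldExtType rat).

Lemma sum_embeddings : exists emb : 'I_(\dim {:L}) -> {rmorphism L -> R[i]},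
  forall f : (L -> R[i]) -> R,
    \sum_(s \in range (fun s : {rmorphism L -> R[i]} => (s : L -> R[i]))) f s =
    \sum_i f (emb i).
Proof.
have [emb [inj_emb all_emb]] := @embedding_enum L R[i].
exists emb => f; pose h i := emb i : L -> R[i].
have -> : range (fun s : {rmorphism L -> R[i]} => (s : L -> R[i])) = h @` [set: 'I_(\dim {:L})].
  apply/seteqP; split=> [_ [s _ <-]|_ [i _ <-]]; last by exists (emb i).
  by have [i si] := all_emb s; exists i => //; apply/funext => x; rewrite si.
rewrite fsbig_image; last first.
  by move=> i j _ _ ij; apply: inj_emb => x; rewrite -/(h i x) ij.
rewrite (fsbig_fwiden (index_enum 'I_(\dim {:L}))) ?index_enum_uniq //.
  by move=> i _; rewrite /= mem_index_enum.
by move=> i [_ []].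
Qed.

Let archimedean (f : (L -> R[i]) -> R) :=
  \sum_(s \in range (fun s : {rmorphism L -> R[i]} => (s : L -> R[i]))) f s.

Let local_height (I : finType) (y : I -> L) (v : L -> R) := ln (\big[Num.max/0]_i v (y i)).

Let finite_part (I : finType) (y : I -> L) :=
  \sum_(v \in [set v : L -> R | finite_place v]) local_height y v.

Lemma finite_part_le_add (I J K : finType) (x : I -> L) (y : J -> L) (z : K -> L) :
    (forall v, finite_place v -> local_height x v <= local_height y v + local_height z v) ->
  finite_part x <= finite_part y + finite_part z.
Proof.
by move=> le_xyz; apply: ler_fsum_add => //; exact: finite_support_ln_place.
Qed.

Lemma local_height_unit (x : L) (v : L -> R) : finite_place v ->
  local_height (fun _ : unit => x) v = ln (v x).
Proof.
move=> hv; congr ln; apply/eqP; rewrite eq_le (bigmax_sup tt) // andbT.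
by apply/bigmax_leP; split=> //; exact: place_ge0.
Qed.

Let dimL_gt0 : 0 < (\dim {:L})%:R :> R.
Proof. by rewrite ltr0n (adim_gt0 {:L}%AS). Qed.

(** With y_k = a_k + N b_k, the archimedean maxima are at least |y_j| = N.  At a
    finite place a_i = y_i - b_i y_j bounds the maximum of the y_k from below by
    |a_i| / max(1, |b_i|), which does not depend on N. *)
Lemma field_height_lower (m : nat) (a b : 'I_m -> L) (i j : 'I_m) :
    a j = 0 -> b j = 1 -> a i != 0 ->
  exists c : R, forall N, (0 < N)%N ->
    ln (N%:R : R) - c <= field_height R (fun k => a k + N%:R * b k).
Proof.
move=> aj bj ai.
(* The families 1, b_i and a_i contribute max(1, |b_i|_v) and |a_i|_v. *)
pose c0 := finite_part (fun o : option unit => if o is Some _ then b i else 1) -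
           finite_part (fun _ : unit => a i).
exists ((\dim {:L})%:R^-1 * c0) => N N0; pose y k := a k + N%:R * b k.
have arch : (\dim {:L})%:R * ln (N%:R : R) <=
    archimedean (fun s => ln (\big[Num.max/0]_(k < m) Normc.normc (s (y k)))).
  have [emb embE] := sum_embeddings; rewrite /archimedean embE.
  rewrite -[X in X%:R * _]card_ord mulr_natl -sumr_const ler_sum // => s _.
  have le_max : N%:R <= \big[Num.max/0]_(k < m) Normc.normc (emb s (y k)).
    rewrite (bigmax_sup j) // /y aj bj add0r mulr1 rmorph_nat.
    by rewrite normc_nat.
  by rewrite ler_ln ?posrE ?ltr0n // (lt_le_trans _ le_max) ?ltr0n.
have fin : - c0 <= finite_part y.
  rewrite /c0 opprB lerBlDl; apply: finite_part_le_add => v hv.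
  rewrite local_height_unit //  /local_height.
  set B := \big[_/_]_o _; set M := \big[_/_]_k _.
  have B1 : 1 <= B by rewrite /B (bigmax_sup None) // place1.
  have Bb : v (b i) <= B by rewrite /B (bigmax_sup (Some tt)).
  have B0 : 0 < B by rewrite (lt_le_trans ltr01).
  have M0 : 0 <= M by exact: bigmax_ge_id.
  have yM k : v (y k) <= M by rewrite /M (bigmax_sup k).
  have aBM : v (a i) <= B * M.
    rewrite -[a i](addrK (N%:R * b i)) -/(y i) place_add_le //.
      by rewrite (le_trans (yM i)) // ler_peMl.
    rewrite placeN // placeM // mulrC ler_pM ?place_ge0 //.
    by have := yM j; rewrite /y aj bj add0r mulr1.
  have ai0 := place_gt0 hv ai.
  have Mpos : 0 < M by rewrite -(pmulr_rgt0 _ B0) (lt_le_trans ai0).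
  by rewrite -lnM ?posrE // ler_ln ?posrE // mulr_gt0.
rewrite /field_height -(ler_pM2l dimL_gt0) mulrA divff ?gt_eqF // mul1r.
rewrite mulrBr mulrA divff ?gt_eqF // mul1r.
exact: lerD.
Qed.

(** At an archimedean place each value is at most N^D times the sum of the
    absolute values of the coefficients; at a finite place it is at most their
    maximum, since |N| <= 1. *)
Lemma field_height_upper (m D : nat) (G : 'I_m -> {poly L}) :
    (forall i, (size (G i) <= D.+1)%N) ->
  exists c : R, forall N, (0 < N)%N ->
    field_height R (fun i => (G i).[N%:R]) <= D%:R * ln (N%:R : R) + c.
Proof.
move=> szG.
(* The 1 in A and in coefs keeps the bounds at least 1, as ler_ln_ge1 requires. *)
pose A (s : L -> R[i]) : R := 1 + \sum_(i < m) \sum_(k < D.+1) Normc.normc (s (G i)`_k).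
pose coefs (o : option ('I_m * 'I_D.+1)) := if o is Some ik then (G ik.1)`_ik.2 else 1.
exists ((\dim {:L})%:R^-1 * (archimedean (fun s => ln (A s)) + finite_part coefs)) => N N0.
pose y i := (G i).[N%:R].
have yE i : y i = \sum_(k < D.+1) (G i)`_k * N%:R ^+ k.
  by rewrite /y (horner_coef_wide _ (szG i)).
have N1 : 1 <= N%:R :> R by rewrite ler1n.
have arch : archimedean (fun s => ln (\big[Num.max/0]_(k < m) Normc.normc (s (y k)))) <=
    (\dim {:L})%:R * (D%:R * ln (N%:R : R)) + archimedean (fun s => ln (A s)).
  have [emb embE] := sum_embeddings; rewrite /archimedean !embE.
  rewrite -[X in X%:R * _]card_ord [X in _ <= X + _]mulr_natl -sumr_const.
  rewrite -big_split ler_sum //= => s _.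
  have A1 : 1 <= A (emb s).
    by rewrite lerDl sumr_ge0 // => i _; rewrite sumr_ge0 // => k _; exact: normc_ge0.
  have ND1 : 1 <= N%:R ^+ D :> R by rewrite exprn_ege1.
  rewrite addrC mulr_natl -lnXn ?ltr0n // -lnM ?posrE ?(lt_le_trans ltr01) //.
  apply: ler_ln_ge1; first by rewrite mulr_ege1.
  apply/bigmax_leP; split; first by rewrite mulr_ge0 // ltW // (lt_le_trans ltr01).
  move=> i _; rewrite yE rmorph_sum; apply: le_trans (normc_sum _ _ _) _.
  apply: (@le_trans _ _ ((\sum_(k < D.+1) Normc.normc (emb s (G i)`_k)) * N%:R ^+ D)).
    rewrite mulr_suml ler_sum // => k _.
    rewrite rmorphM Normc.normcM -natrX rmorph_nat normc_nat natrX.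
    by rewrite ler_wpM2l ?normc_ge0 // ler_weXn2l // -ltnS.
  rewrite ler_wpM2r ?(le_trans ler01) //.
  have sum_ge0 j : 0 <= \sum_(k < D.+1) Normc.normc (emb s (G j)`_k).
    by rewrite sumr_ge0 // => k _; exact: normc_ge0.
  by rewrite /A (bigD1 i) //= addrCA lerDl addr_ge0 // sumr_ge0.
have fin : finite_part y <= finite_part coefs.
  have part1 : finite_part (fun _ : unit => 1) = 0.
    by apply: fsbig1 => v hv; rewrite local_height_unit // place1 // ln1.
  rewrite -[X in _ <= X]addr0 -part1; apply: finite_part_le_add => v hv.
  rewrite local_height_unit // place1 // ln1 addr0 /local_height.
  have coefs1 : 1 <= \big[Num.max/0]_o v (coefs o) by rewrite (bigmax_sup None) // place1.
  apply: ler_ln_ge1 => //; apply/bigmax_leP; split=> [|i _]; first exact: le_trans coefs1.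
  rewrite yE; apply: place_sum_le => // [|k _]; first exact: le_trans coefs1.
  rewrite (bigmax_sup (Some (i, k))) // placeM // ler_piMr ?place_ge0 //.
  by rewrite -natrX place_nat.
rewrite /field_height -(ler_pM2l dimL_gt0) mulrA divff ?gt_eqF // mul1r.
rewrite mulrDr [X in _ <= _ + X]mulrA divff ?gt_eqF // mul1r addrA.
exact: lerD.
Qed.
End HeightBounds.

(** * The number field in which a height is computed *)

Lemma adjoin_seq_ind (L : fieldExtType rat) (P : L -> Prop) (rs : seq L) :
    (forall c : rat, P c%:A) -> (forall x y, P x -> P y -> P (x + y)) ->
    (forall x y, P x -> P y -> P (x * y)) -> (forall r, r \in rs -> P r) ->
  forall x, x \in <<1 & rs>>%VS -> P x.
Proof.
move=> PQ PD PM; elim/last_ind: rs => [_ x|rs r IH Prs x].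
  rewrite Fadjoin_nil => /vlineP[c ->]; exact: PQ.
rewrite adjoin_rcons => /Fadjoin_polyP[p /polyOverP pK ->].
have P0 : P 0 by rewrite -(scale0r 1).
have P1 : P 1 by rewrite -(scale1r 1).
rewrite horner_coef; apply: (big_ind P) => // k _; apply: (PM).
  by apply: IH => [y ys|]; [apply: Prs; rewrite mem_rcons inE ys orbT | exact: pK].
elim: (k : nat) => [|e IHe]; first by rewrite expr0.
by rewrite exprS; apply: PM => //; apply: Prs; rewrite mem_rcons mem_head.
Qed.

(** It suffices to find preimages of generators, since the elements of L whose
    image under iota lies in the image of iota' form a subfield. *)
Lemma embedding_factor (L L' : fieldExtType rat) (C : fieldType)
    (iota : {rmorphism L -> C}) (iota' : {rmorphism L' -> C}) (rs : seq L) :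
    <<1 & rs>>%VS = fullv -> (forall r, r \in rs -> exists r', iota' r' = iota r) ->
  exists phi : {rmorphism L -> L'}, forall x, iota' (phi x) = iota x.
Proof.
move=> gen_rs ex_rs; have ex x : exists x', iota' x' = iota x.
  have : x \in <<1 & rs>>%VS by rewrite gen_rs memvf.
  apply: (adjoin_seq_ind (P := fun x => exists x', iota' x' = iota x)) ex_rs x.
  - by move=> c; exists c%:A; rewrite -!in_algE -[LHS]/((iota' \o in_alg _) c)
     -[RHS]/((iota \o in_alg _) c) !fmorph_eq_rat.
  - by move=> x y [u ux] [w wy]; exists (u + w); rewrite !rmorphD ux wy.
  - by move=> x y [u ux] [w wy]; exists (u * w); rewrite !rmorphM ux wy.
pose phi x := sval (cid (ex x)).
have phiE x : iota' (phi x) = iota x by exact: svalP (cid (ex x)).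
have phiB : zmod_morphism phi.
  by move=> x y; apply: (fmorph_inj iota'); rewrite rmorphB !phiE rmorphB.
have phiM : monoid_morphism phi.
  split=> [|x y]; apply: (fmorph_inj iota'); first by rewrite phiE !rmorph1.
  by rewrite rmorphM !phiE rmorphM.
pose phiZ := GRing.isZmodMorphism.Build _ _ phi phiB.
pose phiX := GRing.isMonoidMorphism.Build _ _ phi phiM.
pose Phi : {rmorphism L -> L'} := HB.pack phi phiZ phiX.
by exists Phi.
Qed.

Section Isomorphism.
Variables (R : realType) (L L' : fieldExtType rat).
Variables (phi : {rmorphism L -> L'}) (psi : {rmorphism L' -> L}).
Hypotheses (phiK : cancel phi psi) (psiK : cancel psi phi).

Lemma dim_iso : \dim {:L} = \dim {:L'}.
Proof.
pose phiZ := GRing.isScalable.Build _ _ _ _ (phi : L -> L') (fmorph_numZ phi).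
pose f : {linear L -> L'} := HB.pack (phi : L -> L') phi phiZ.
have kerf : lker (linfun f) == 0%VS.
  by apply/lker0P => x y; rewrite !lfunE => /(can_inj phiK).
rewrite -(limg_dim_eq (f := linfun f)) ?(eqP kerf) ?capv0 //.
congr (\dim _); apply/vspaceP => x; rewrite memvf.
by apply/memv_imgP; exists (psi x); rewrite ?memvf // lfunE /= psiK.
Qed.

Lemma finite_place_comp (v : L' -> R) : finite_place v -> finite_place (v \o phi).
Proof.
case=> v0 vM vD [q [[r [r1 Hr]] vE]]; split=> [|x y|x y|] /=; rewrite ?rmorph0 ?rmorphM ?rmorphD //.
exists q; split.
  exists (psi \o r); split=> [i|x /Hr]; first by rewrite /= psiK.
  case=> i [vi iu]; exists i; split=> [|j]; rewrite /= rmorphB psiK //; exact: iu.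
rewrite -vE; apply/seteqP; split=> _ [x /= x0 <-].
  by exists (phi x) => //=; rewrite fmorph_eq0.
by exists (psi x) => /=; rewrite ?fmorph_eq0 // psiK.
Qed.
End Isomorphism.

Lemma field_height_iso (R : realType) (L L' : fieldExtType rat)
    (phi : {rmorphism L -> L'}) (psi : {rmorphism L' -> L}) (m : nat) (y : 'I_m -> L) :
    cancel phi psi -> cancel psi phi ->
  field_height R (phi \o y) = field_height R y.
Proof.
move=> phiK psiK; rewrite /field_height (dim_iso phiK psiK); congr (_ * (_ + _)).
  symmetry; apply: (reindex_fsbig (fun s : L' -> R[i] => s \o phi)); split.
  - by move=> _ [s _ <-]; exists (s \o phi : {rmorphism L -> R[i]}).
  - move=> s t _ _ st; apply/funext => x; rewrite -(psiK x).
    exact: (congr1 (fun f => f (psi x)) st).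
  - move=> _ [s _ <-]; exists (s \o psi); first by exists (s \o psi : {rmorphism L' -> R[i]}).
    by apply/funext => x /=; rewrite phiK.
symmetry; apply: (reindex_fsbig (fun v : L' -> R => v \o phi)); split.
- by move=> v hv; apply: finite_place_comp hv; exact: psiK.
- move=> v w _ _ vw; apply/funext => x; rewrite -(psiK x).
  exact: (congr1 (fun f => f (psi x)) vw).
- move=> v hv; exists (v \o psi); first by apply: finite_place_comp hv; exact: phiK.
  by apply/funext => x /=; rewrite phiK.
Qed.

(** Two fields generated by copies of the same coordinates have the same image in
    the algebraic numbers, so they are isomorphic by an isomorphism that carries
    one list of coordinates to the other. *)
Lemma weil_heightE (R : realType) (n : nat) (x : 'rV[algC]_n.+1)
    (L : fieldExtType rat) (iota : {rmorphism L -> algC}) (y : 'I_n.+1 -> L) :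
    (forall i, iota (y i) = x 0 i) -> <<1 & [seq y i | i <- enum 'I_n.+1]>>%VS = fullv ->
  weil_height R x = field_height R y.
Proof.
move=> yx geny; rewrite /weil_height.
case: num_field_exists => L' [iota' [s sx gens]].
have szs : size s = n.+1 by rewrite -(size_map iota') sx size_map size_enum_ord.
have sE (i : 'I_n.+1) : iota' s`_i = iota (y i).
  by rewrite -(nth_map _ 0) ?szs // sx (nth_map i) ?size_enum_ord // nth_ord_enum yx.
have [phi phiE] : exists phi : {rmorphism L -> L'}, forall x, iota' (phi x) = iota x.
  by apply: embedding_factor geny _ => _ /mapP[i _ ->]; exists s`_i.
have [psi psiE] : exists psi : {rmorphism L' -> L}, forall x, iota (psi x) = iota' x.
  apply: embedding_factor gens _ => _ /(nthP 0)[i lti <-].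
  by rewrite szs in lti; exists (y (Ordinal lti)); rewrite -sE.
have phiK : cancel phi psi by move=> z; apply: (fmorph_inj iota); rewrite psiE phiE.
have psiK : cancel psi phi by move=> z; apply: (fmorph_inj iota'); rewrite phiE psiE.
rewrite -(field_height_iso R y phiK psiK); congr field_height; apply/funext => i.
by apply: (fmorph_inj iota'); rewrite sE /= phiE.
Qed.

(** Otherwise natural roots could be picked one after the other, each larger
    than the previous ones, until they are more than the degree allows. *)
Lemma near_nat_not_root (C : numDomainType) (q : {poly C}) : q != 0 ->
  \forall N \near \oo, q.[N%:R] != 0.
Proof.
move=> q0; apply: contrapT => often.
have next B : {N | (B <= N)%N & q.[N%:R] == 0}.
  apply: cid2; apply: contrapT => none; apply: often; exists B => // N BN.
  by apply/negP => qN; apply: none; exists N.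
pose fix roots k : seq nat :=
  if k is k'.+1 then let s := roots k' in s2val (next (\max_(N <- s) N).+1) :: s else [::].
have roots0 k : all (root q) [seq N%:R | N <- roots k].
  elim: k => //= k ->; rewrite andbT; case: (next _) => N /= _; exact.
have uniq_roots k : uniq [seq (N%:R : C) | N <- roots k].
  rewrite map_inj_uniq; last by move=> M N /eqP; rewrite eqr_nat => /eqP.
  elim: k => //= k ->; rewrite andbT; case: (next _) => N /= ltN _.
  apply/negP => Nin; move: ltN; rewrite ltnNge => /negP[].
  by rewrite (big_rem N) //= leq_maxl.
have size_roots k : size (roots k) = k by elim: k => //= k ->.
have := max_poly_roots q0 (roots0 (size q)) (uniq_roots (size q)).
by rewrite size_map size_roots ltnn.
Qed.

(** The conjugates of z are roots of its minimal polynomial over Q, which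
    therefore has degree at least [L : Q]. *)
Lemma generator_of_distinct_conjugates (L : fieldExtType rat) (C : numClosedFieldType)
    (z : L) (emb : 'I_(\dim {:L}) -> {rmorphism L -> C}) :
  injective (fun i => emb i z) -> <<1; z>>%VS = fullv.
Proof.
move=> inj; have /polyOver1P[m Dm] := minPolyOver 1%AS z.
have m0 : map_poly (ratr : rat -> C) m != 0.
  by rewrite map_poly_eq0 -(map_poly_eq0 (in_alg L)) -Dm monic_neq0 // monic_minPoly.
have mz : all (root (map_poly (ratr : rat -> C) m)) [seq emb i z | i <- enum 'I_(\dim {:L})].
  apply/allP => _ /mapP[i _ ->]; apply/rootP.
  transitivity (emb i (map_poly (in_alg L) m).[z]); last by rewrite -Dm minPolyxx rmorph0.
  rewrite -horner_map -map_poly_comp; congr _.[_]; apply: eq_map_poly => a /=.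
  by rewrite alg_num_field fmorph_rat.
have := max_poly_roots m0 mz; rewrite map_inj_uniq // enum_uniq => /(_ isT).
rewrite size_map size_enum_ord size_map_poly -(size_map_poly (in_alg L)) -Dm size_minPoly ltnS.
have := dim_Fadjoin 1%AS z; rewrite /= dimv1 muln1 => <- le_dim.
by apply/eqP; rewrite eqEdim subvf.
Qed.

(** Two distinct embeddings of L differ at some coefficient of some G_k, so they
    also differ at G_k(N), unless N is a root of a nonzero polynomial.  For large
    N this excludes all the pairs of embeddings.  Then a primitive
    element of the subfield generated by the values G_k(N) has [L : Q] distinct
    conjugates, and this subfield is L. *)
Lemma near_nat_generate (L : fieldExtType rat) (m : nat) (G : 'I_m -> {poly L}) (rs : seq L) :
    <<1 & rs>>%VS = fullv -> (forall r, r \in rs -> exists i k, r = (G i)`_k) ->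
  \forall N \near \oo, <<1 & [seq (G i).[N%:R] | i <- enum 'I_m]>>%VS = fullv.
Proof.
move=> gen_rs coef_rs; have [emb [inj_emb _]] := @embedding_enum L algC.
have agree (f g : {rmorphism L -> algC}) (s : seq L) :
    (forall x, x \in s -> f x = g x) -> forall x, x \in <<1 & s>>%VS -> f x = g x.
  move=> fg; apply: adjoin_seq_ind fg; first by move=> c; rewrite !alg_num_field !fmorph_rat.
    by move=> x y fx fy; rewrite !rmorphD fx fy.
  by move=> x y fx fy; rewrite !rmorphM fx fy.
have separate (ij : 'I_(\dim {:L}) * 'I_(\dim {:L})) : \forall N \near \oo,
    ij.1 != ij.2 -> exists k, emb ij.1 (G k).[N%:R] != emb ij.2 (G k).[N%:R].
  case: ij => i j /=; have [->|ij] := eqVneq i j; first exact: nearW.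
  have [k Gk] : exists k, map_poly (emb i) (G k) - map_poly (emb j) (G k) != 0.
    apply: contrapT => same; move/eqP: ij; apply; apply: inj_emb => x.
    apply: (agree _ _ rs); last by rewrite gen_rs memvf.
    move=> _ /coef_rs[k [e ->]].
    have [//|neq] := eqVneq (emb i (G k)`_e) (emb j (G k)`_e); case: same.
    exists k; apply: contra neq => /eqP/(congr1 (fun p : {poly algC} => p`_e)) /eqP.
    by rewrite coefB !coef_map coef0 subr_eq0.
  apply: filterS (near_nat_not_root Gk) => N GkN _; exists k.
  move: GkN; rewrite hornerD hornerN subr_eq0.
  have horner_nat (f : {rmorphism L -> algC}) : (map_poly f (G k)).[N%:R] = f (G k).[N%:R].
    by rewrite -horner_map rmorph_nat.
  by rewrite !horner_nat.
apply: filterS (filter_forall _ separate) => N sepN.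
set ys := [seq _ | i <- _].
have [z zM genz] := number_field_primitive <<1 & ys>>%AS.
have zgen : <<1; z>>%VS = fullv.
  apply: (@generator_of_distinct_conjugates L algC z emb) => i j /= zij; apply/eqP.
  apply: contraT => ij; have [k /eqP[]] := sepN (i, j) ij.
  apply: (agree _ _ [:: z]); first by move=> x; rewrite inE => /eqP ->.
  by rewrite adjoin_seq1 genz seqv_sub_adjoin //; apply/mapP; exists k; rewrite ?mem_enum.
by rewrite -zgen genz.
Qed.

(** * Forms restricted to a line *)

Lemma digits_inj (B m : nat) (u w : 'I_m -> nat) :
    (forall i, (u i < B)%N) -> (forall i, (w i < B)%N) ->
    (\sum_(i < m) u i * B ^ i = \sum_(i < m) w i * B ^ i)%N -> u =1 w.
Proof.
elim: m u w => [|m IH] u w uB wB; first by move=> _ [].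
have shift (x : 'I_m.+1 -> nat) : (\sum_(i < m.+1) x i * B ^ i =
    x ord0 + B * \sum_(i < m) x (lift ord0 i) * B ^ i)%N.
  rewrite big_ord_recl expn0 muln1; congr addn; rewrite big_distrr; apply: eq_bigr => i _.
  by rewrite expnS mulnCA.
have B0 : (0 < B)%N by exact: leq_ltn_trans (uB ord0).
rewrite !shift => eq_uw.
have mod_B (x : 'I_m.+1 -> nat) k : (x ord0 < B)%N -> ((x ord0 + B * k) %% B = x ord0)%N.
  by move=> xB; rewrite addnC mulnC modnMDl modn_small.
have u0 : u ord0 = w ord0 by have := congr1 (modn^~ B) eq_uw; rewrite /= !mod_B.
move: eq_uw; rewrite u0 => /addnI /eqP; rewrite eqn_pmul2l // => /eqP eq_uw i.
have [j ->|->//] := unliftP ord0 i.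
by apply: (IH (u \o lift ord0) (w \o lift ord0)) => // k /=.
Qed.

(** Kronecker substitution: for B larger than all the exponents, x_i := t^(B^i)
    sends distinct monomials to distinct powers of t, hence p to a nonzero
    polynomial in t, which does not vanish at a large natural number. *)
Lemma mpoly_nonvanishing (F : numFieldType) (m : nat) (p : mpoly m F) :
  p != 0 -> exists x, meval x p != 0.
Proof.
rewrite -msupp_eq0 => p0; have [mu mu_p] : exists mu, mu \in msupp p.
  by case: (msupp p) p0 => // mu s _; exists mu; rewrite mem_head.
pose B := (\max_(nu <- msupp p) mdeg nu).+1.
have expB nu i : nu \in msupp p -> (nu i < B)%N.
  move=> nu_p; rewrite ltnS (big_rem nu) //=; apply: leq_trans (leq_maxl _ _).
  by rewrite mdegE (bigD1 i) //= leq_addr.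
pose w (nu : multinom m) := (\sum_(i < m) nu i * B ^ i)%N.
(* The polynomial p(t, t^B, t^(B^2), ...). *)
pose q : {poly F} := \sum_(nu <- msupp p) (mcoeff nu p) *: 'X^(w nu).
have q0 : q != 0.
  apply/eqP => /(congr1 (fun q : {poly F} => q`_(w mu))); rewrite coef0 coef_sum.
  rewrite (bigD1_seq mu) ?msupp_uniq //= coefZ coefXn eqxx mulr1 big_seq_cond big1 ?addr0.
    by move/eqP; rewrite mcoeff_eq0 mu_p.
  move=> nu /andP[nu_p neq]; rewrite coefZ coefXn; case: eqP => [eq_w|]; last by rewrite mulr0.
  case/eqP: neq; apply/mnmP; apply: (digits_inj (B := B)) => // i; exact: expB.
have [N qN] := filter_ex (near_nat_not_root q0).
exists (fun i => N%:R ^+ (B ^ i)); move: qN; rewrite horner_sum mevalE.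
congr (_ != 0); apply: eq_bigr => nu _; rewrite hornerZ hornerXn; congr (_ * _).
rewrite /w -prodrXr; apply: eq_bigr => i _; by rewrite -exprM mulnC.
Qed.

Section Line.
Variables (F : fieldType) (m : nat) (a b : 'I_m -> F).

Definition restrict_to_line (p : mpoly m F) : {poly F} :=
  mmap polyC (fun k => (a k)%:P + b k *: 'X) p.

Lemma horner_restrict_to_line p t :
  (restrict_to_line p).[t] = meval (fun k => a k + t * b k) p.
Proof.
rewrite horner_sum mevalE; apply: eq_bigr => nu _.
rewrite hornerM hornerC horner_prod; congr (_ * _); apply: eq_bigr => k _.
by rewrite horner_exp hornerD hornerC hornerZ hornerX mulrC.
Qed.

Let top d c (p : {poly F}) := (size p <= d.+1)%N /\ p`_d = c.

Let topM d e c c' p q : top d c p -> top e c' q -> top (d + e) (c * c') (p * q).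
Proof.
move=> [szp <-] [szq <-]; split.
  by have := size_polyMleq p q; lia.
rewrite coefM (bigD1 (inord d)) //= inordK ?ltnS ?leq_addr // addKn.
rewrite big1 ?addr0 // => j neq; have [lt_jd|le_dj] := ltnP j d.
  by rewrite [q`__]nth_default ?mulr0 // (leq_trans szq) //; lia.
rewrite nth_default ?mul0r // (leq_trans szp) // ltn_neqAle le_dj andbT.
by apply: contra neq => /eqP dj; apply/eqP/val_inj; rewrite /= inordK // ltnS leq_addr.
Qed.

(** The coefficient of t^d in p(a + t b) is the value of p at the point at
    infinity of the line. *)
Lemma restrict_to_line_homogeneous d p : homogeneous d p ->
  (size (restrict_to_line p) <= d.+1)%N /\ (restrict_to_line p)`_d = meval b p.
Proof.
move=> /allP /= hom.
have top_monomial nu : nu \in msupp p ->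
    top d (\prod_(k < m) b k ^+ nu k) (mmap1 (fun k => (a k)%:P + b k *: 'X) nu).
  move/hom => /eqP <-; rewrite mdegE.
  have top1 : top 0 1 1 by split; rewrite ?size_poly1 ?coef1.
  apply: (big_ind3 top) => // [|k _]; first by move=> *; exact: topM.
  elim: (nu k) => [|e IH]; first by rewrite !expr0.
  rewrite !exprS -add1n; apply: topM => //; split.
    apply: leq_trans (size_polyD _ _) _; rewrite geq_max (leq_trans (size_polyC_leq1 _)) //.
    by rewrite (leq_trans (size_scale_leq _ _)) // size_polyX.
  by rewrite coefD coefC coefZ coefX add0r mulr1.
split.
  apply: (leq_trans (size_sum _ _ _)); apply/bigmax_leqP_seq => nu nu_p _.
  rewrite mul_polyC (leq_trans (size_scale_leq _ _)) //.
  by case: (top_monomial _ nu_p).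
rewrite coef_sum mevalE big_seq [RHS]big_seq; apply: eq_bigr => nu nu_p.
by rewrite coefCM; case: (top_monomial _ nu_p) => _ ->.
Qed.
End Line.

Lemma meval_homogeneous_scale (F : fieldType) (m d : nat) (p : mpoly m F) (c : F) (x : 'I_m -> F) :
  homogeneous d p -> meval (fun k => c * x k) p = c ^+ d * meval x p.
Proof.
move=> /allP /= hom; rewrite !mevalE big_distrr /= big_seq [RHS]big_seq.
apply: eq_bigr => nu /hom /eqP <-; rewrite mulrCA; congr (_ * _).
rewrite mdegE -prodrXr -big_split /=; apply: eq_bigr => k _.
by rewrite exprMn.
Qed.

(** * The height along a line and the theorem *)

(** The field generated by all the coefficients of the F_i. *)
Lemma descend_polynomials (m : nat) (F : 'I_m -> {poly algC}) :
  exists (L : fieldExtType rat) (iota : {rmorphism L -> algC}) (G : 'I_m -> {poly L}) (rs : seq L),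
  [/\ forall i, map_poly iota (G i) = F i, <<1 & rs>>%VS = fullv &
      forall r, r \in rs -> exists i k, r = (G i)`_k].
Proof.
pose cs := flatten [seq (F i : seq algC) | i <- enum 'I_m].
have [L [iota [rs rsE gen_rs]]] := num_field_exists cs.
have pre i k : {g | iota g = (F i)`_k}.
  apply: cid; have [lt_k|le_k] := ltnP k (size (F i)); last first.
    by exists 0; rewrite rmorph0 nth_default.
  have : (F i)`_k \in map iota rs.
    rewrite rsE; apply/flattenP; exists (F i : seq algC); last exact: mem_nth.
    by apply/mapP; exists i; rewrite ?mem_enum.
  by case/mapP => g _ ->; exists g.
pose G i := \poly_(k < size (F i)) sval (pre i k).
have GE i : map_poly iota (G i) = F i.
  apply/polyP => k; rewrite coef_map coef_poly; case: ltnP => [_|le_k].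
    by case: (pre i k).
  by rewrite /= rmorph0 nth_default.
exists L, iota, G, rs; split=> // r r_rs.
have : iota r \in cs by rewrite -rsE map_f.
case/flattenP => _ /mapP[i _ ->] /(nthP 0)[k _ rk].
by exists i, k; apply: (fmorph_inj iota); rewrite -coef_map GE.
Qed.

(** The field L, which does not depend on N, is the one in which the height is
    computed once N is large. *)
Lemma near_weil_height (R : realType) (n : nat) (F : 'I_n.+1 -> {poly algC}) :
  exists (L : fieldExtType rat) (iota : {rmorphism L -> algC}) (G : 'I_n.+1 -> {poly L}),
  (forall i, map_poly iota (G i) = F i) /\
  \forall N \near \oo, forall x : 'rV[algC]_n.+1, (forall i, x 0 i = (F i).[N%:R]) ->
    weil_height R x = field_height R (fun i => (G i).[N%:R]).
Proof.
have [L [iota [G [rs [GE gen_rs coef_rs]]]]] := descend_polynomials F.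
exists L, iota, G; split=> //; apply: filterS (near_nat_generate gen_rs coef_rs) => N genN x xE.
apply: (@weil_heightE R n x L iota _ _ genN) => i.
by rewrite xE -GE -horner_map rmorph_nat.
Qed.

Lemma near_weil_height_upper (R : realType) (n D : nat) (F : 'I_n.+1 -> {poly algC}) :
    (forall i, (size (F i) <= D.+1)%N) ->
  exists c : R, \forall N \near \oo, forall x : 'rV[algC]_n.+1,
    (forall i, x 0 i = (F i).[N%:R]) -> weil_height R x <= D%:R * ln (N%:R : R) + c.
Proof.
move=> szF; have [L [iota [G [GE hG]]]] := near_weil_height R F.
have [|c Hc] := @field_height_upper R L n.+1 D G.
  by move=> i; rewrite -(size_map_poly iota) GE.
exists c; have N_gt0 : \forall N \near \oo, (0 < N)%N by exists 1%N.
apply: filterS (filterI hG N_gt0) => N [hN N0] x xE.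
by rewrite hN // Hc.
Qed.

Lemma near_weil_height_lower (R : realType) (n : nat) (a b : 'I_n.+1 -> algC) (i j : 'I_n.+1) :
    a j = 0 -> b j = 1 -> a i != 0 ->
  exists c : R, \forall N \near \oo, forall x : 'rV[algC]_n.+1,
    (forall k, x 0 k = a k + N%:R * b k) -> ln (N%:R : R) - c <= weil_height R x.
Proof.
move=> aj bj ai; pose F k : {poly algC} := (a k)%:P + b k *: 'X.
have [L [iota [G [GE hG]]]] := near_weil_height R F.
have G0 k : iota (G k)`_0 = a k.
  by rewrite -coef_map GE coefD coefC coefZ coefX mulr0 addr0.
have G1 k : iota (G k)`_1 = b k.
  by rewrite -coef_map GE coefD coefC coefZ coefX mulr1 add0r.
have szG k : (size (G k) <= 2)%N.
  rewrite -(size_map_poly iota) GE (leq_trans (size_polyD _ _)) // geq_max.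
  rewrite (leq_trans (size_polyC_leq1 _)) //.
  by rewrite (leq_trans (size_scale_leq _ _)) // size_polyX.
have [|||c Hc] := @field_height_lower R L n.+1 (fun k => (G k)`_0) (fun k => (G k)`_1) i j.
- by apply: (fmorph_inj iota); rewrite G0 aj rmorph0.
- by apply: (fmorph_inj iota); rewrite G1 bj rmorph1.
- by rewrite -(fmorph_eq0 iota) G0.
exists c; have N_gt0 : \forall N \near \oo, (0 < N)%N by exists 1%N.
apply: filterS (filterI hG N_gt0) => N [hN N0] x xE; rewrite hN => [|k]; last first.
  by rewrite xE /F hornerD hornerC hornerZ hornerX mulrC.
rewrite (_ : (fun k => (G k).[N%:R]) = (fun k => (G k)`_0 + N%:R * (G k)`_1)) ?Hc //.
apply/funext => k; rewrite (horner_coef_wide _ (szG k)) !big_ord_recl big_ord0.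
by rewrite addr0 expr0 mulr1 mulrC.
Qed.

Lemma near_ln_ge (R : realType) (K : R) : \forall N \near \oo, K <= ln (N%:R : R).
Proof.
exists (Num.Def.archi_bound (sequences.expR K)) => // N /= leN.
have ltKN : sequences.expR K < N%:R.
  by apply: lt_le_trans (archi_boundP (expR_ge0 _)) _; rewrite ler_nat.
by rewrite -[K]expRK ler_ln ?posrE ?expR_gt0 ?(lt_trans (expR_gt0 K)) // ltW.
Qed.

Lemma homogeneous_map_mpoly (F F' : fieldType) (iota : {rmorphism F -> F'}) (m d : nat)
  (p : mpoly m F) : homogeneous d p -> homogeneous d (map_mpoly iota p).
Proof.
move=> /allP hom; apply/allP => nu.
by rewrite (perm_mem (msupp_map_mpoly _ (fmorph_inj iota))) => /hom.
Qed.

(** If all the coordinates were 0, then 0 would be a common factor, hence a unit. *)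
Lemma coordinateC_neq0 (K : fieldType) (iota : {rmorphism K -> algC}) (n : nat)
  (f : rational_map K n) : exists i, coordinateC iota f i != 0.
Proof.
apply: contrapT => all0; have : (0 : mpoly n.+1 K) \is a GRing.unit.
  apply: (@no_common_factor _ _ f _ (fun=> 0)) => i; rewrite mul0r.
  apply/mpolyP => nu; apply: (fmorph_inj iota); rewrite mcoeff0 rmorph0.
  rewrite -mcoeff_map_mpoly -/(coordinateC iota f i); suff /eqP -> : coordinateC iota f i == 0.
    by rewrite mcoeff0.
  by apply: contrapT => /negP fi; apply: all0; exists i.
by rewrite unitr0.
Qed.

Theorem theoremC (R : realType) (K : fieldExtType rat)
    (iota : {rmorphism K -> algC}) (n : nat) (f : rational_map K n)
    (deg_f : (0 < degree f)%N)
    (U : set 'rV[algC]_n.+1) (openU : zariski_open U) (U_neq0 : U !=set0)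
    (C : R)
    (height_bound : forall P : 'rV[algC]_n.+1,
       U P -> ~ indeterminacy_locus iota f P ->
       ((degree f)%:R)^-1 * weil_height R (image_point iota f P) + C
         > weil_height R P) :
  is_morphism iota f.
Proof.
have homC i : homogeneous (degree f) (coordinateC iota f i).
  exact/homogeneous_map_mpoly/coordinate_homogeneous.
move=> q q_neq0; have [reg|irreg] := pselect (exists i, value_at (coordinateC iota f i) q != 0).
  by exists (degree f), (coordinateC iota f); split=> // i j; rewrite mulrC.
exfalso.
have [j qj] : exists j, q 0 j != 0.
  apply: contrapT => q0; case/eqP: q_neq0; apply/rowP => j; rewrite mxE.
  by apply: contrapT => qj; apply: q0; exists j; apply/eqP.
(* The indeterminacy point is the point at infinity of the line; it is
   normalised by b_j = 1. *)
pose b k := (q 0 j)^-1 * q 0 k.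
have bj : b j = 1 by rewrite /b mulVf.
have fb i : meval b (coordinateC iota f i) = 0.
  rewrite (meval_homogeneous_scale _ _ (homC i)).
  suff /eqP -> : meval (fun k => q 0 k) (coordinateC iota f i) == 0 by rewrite mulr0.
  by apply: contrapT => /negP fi; apply: irreg; exists i.
case: openU => S [homS UE].
have [p Sp p0] : exists2 p, S p & p != 0.
  case: U_neq0 => x; rewrite UE => -[_ [p Sp px]]; exists p => //.
  by apply: contraNneq px => ->; rewrite /value_at meval0.
have [i0 fi0] := coordinateC_neq0 iota f.
have [a0 a0P] := mpoly_nonvanishing (mulf_neq0 p0 fi0).
(* Moving the origin of the line to its point with j-th coordinate 0; the
   original a0 is the point of parameter a0 j. *)
pose a k := a0 k - a0 j * b k.
have aj : a j = 0 by rewrite /a bj mulr1 subrr.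
have a0E : a0 = (fun k => a k + a0 j * b k) by apply/funext => k; rewrite subrK.
(* Otherwise a0 would be a multiple of b, where all the coordinates of f vanish. *)
have [i ai] : exists i, a i != 0.
  apply: contrapT => a_eq0; move: a0P; rewrite mevalM mulf_eq0 => /norP[_ /eqP[]].
  rewrite (_ : a0 = fun k => a0 j * b k).
    by rewrite (meval_homogeneous_scale _ _ (homC i0)) fb mulr0.
  rewrite [LHS]a0E; apply/funext => k; suff -> : a k = 0 by rewrite add0r.
  by apply/eqP/negPn/negP => ak; apply: a_eq0; exists k.
pose F i := restrict_to_line a b (coordinateC iota f i).
have szF k : (size (F k) <= (degree f).-1.+1)%N.
  rewrite prednK //; have [szFk top] := restrict_to_line_homogeneous a b (homC k).
  apply/leq_sizeP => e; rewrite leq_eqVlt => /predU1P[<-|lt_e]; first by rewrite top fb.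
  by rewrite nth_default // (leq_trans szFk).
have line_neq0 : restrict_to_line a b (p * coordinateC iota f i0) != 0.
  apply: contraNneq a0P => line0.
  by rewrite [X in meval X]a0E -horner_restrict_to_line line0 horner0.
have [c1 lower] := near_weil_height_lower R aj bj ai.
have [c2 upper] := near_weil_height_upper R szF.
pose d : R := (degree f)%:R; have d0 : 0 < d by rewrite ltr0n.
(* The bound 1 <= ln N only serves to exclude N = 0. *)
have [N [[[[N0 notroot] low] up] big]] := filter_ex (filterI (filterI (filterI (filterI
   (near_ln_ge (1 : R)) (near_nat_not_root line_neq0)) lower) upper)
   (near_ln_ge (d * (C + c1) + c2))).
pose P : 'rV[algC]_n.+1 := \row_k (a k + N%:R * b k).
have PE k : P 0 k = a k + N%:R * b k by rewrite mxE.
have valP g : value_at g P = meval (fun k => a k + N%:R * b k) g.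
  by apply: meval_eq => k; rewrite PE.
move: notroot; rewrite horner_restrict_to_line mevalM mulf_eq0 -!valP => /norP[pP fP].
have P0 : P != 0.
  apply/eqP => P0; move: N0; have := PE j; rewrite P0 mxE aj bj add0r mulr1.
  move=> /esym/eqP; rewrite pnatr_eq0 => /eqP ->.
  by rewrite ln0 // leNgt ltr01.
have UP : U P by rewrite UE; split=> //; exists p.
have notIP : ~ indeterminacy_locus iota f P.
  by case=> _ /(_ i0) /eqP; rewrite (negbTE fP).
have := height_bound P UP notIP; rewrite ltNge => /negP; apply.
have {}low := low P PE.
have {}up : weil_height R (image_point iota f P) <= (degree f).-1%:R * ln N%:R + c2.
  by apply: up => k; rewrite mxE valP /F horner_restrict_to_line.
apply: le_trans low; rewrite -lerBrDr -(ler_pM2l d0) mulrA divff ?gt_eqF // mul1r.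
apply: le_trans up _.
have -> : (degree f).-1%:R = d - 1 by rewrite /d -[in RHS](prednK deg_f) -natr1 addrK.
rewrite -subr_ge0; move: big; rewrite -subr_ge0; congr (is_true (0 <= _)).
ring.
Qed.
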